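(* Let $m$ and $n$ be positive integers and let $\zeta_{m,n}$ denote the maximum number of nonzero entries in an $m\times n$ sign-restricted matrix. Then $$\zeta_{m,n}=\begin{cases} mn-m^2/4-\lceil (1/2)(n-m/2-1)\rceil, & \text{if } m \text{ is even},\\ mn-(m^2-1)/4-\lceil (1/2)(n-(m+1)/2)\rceil, & \text{if } m \text{ is odd}.\end{cases}$$ In particular, when $m=n$, $$\zeta_{n,n}=\begin{cases}\frac{3n^2-n}{4}, & \text{if } n\equiv 0 \text{ or } 3 \pmod 4,\\ \frac{3n^2-n+2}{4}, & \text{if } n\equiv 1 \text{ or } 2 \pmod 4.\end{cases}$$
   Context: A sign-restricted matrix (SRM) is an $m\times n$ matrix $A=[a_{ij}]$ with entries in $\{0,1,-1\}$ such that every partial column sum $\sum_{k=1}^{i} a_{kj}$ equals $0$ or $1$, and every partial row sum $\sum_{l=1}^{j} a_{il}$ is nonnegative.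
   Formalization: The general formula is stated only for m ≤ 2n+2 and (m ≥ 2 or n = 1), exactly where it holds: for m = 1, n ≥ 2 the all-ones row gives ζ = n, and for m > 2n+2 one has ζ = n², both larger than the formula; the m = n case is unrestricted. *)

(* Defs.v *)
From mathcomp Require Import all_boot all_order all_algebra.
From mathcomp Require Import boolp.
Set Implicit Arguments.
Unset Strict Implicit.
Unset Printing Implicit Defensive.
Import Order.TTheory GRing.Theory Num.Theory.
Local Open Scope ring_scope.

(* Ordinals count from 0, so the sum over k <= i has i.+1 terms. *)
Definition is_srm (m n : nat) (A : 'M[int]_(m, n)) : Prop :=
  [/\ forall i j, A i j \in [:: 0; 1; -1],
      forall i j, \sum_(k < m | (k <= i)%N) A k j \in [:: 0; 1]
    & forall i j, 0 <= \sum_(l < n | (l <= j)%N) A i l].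

Definition num_nonzero (m n : nat) (A : 'M[int]_(m, n)) : nat :=
  #|[set ij : 'I_m * 'I_n | A ij.1 ij.2 != 0]|.

Definition srm_nonzero_count (m n k : nat) : bool :=
  `[< exists2 A : 'M[int]_(m, n), is_srm A & num_nonzero A = k >].

Lemma srm_nonzero_count_ex (m n : nat) : exists k, srm_nonzero_count m n k.
Proof.
exists (num_nonzero (0 : 'M[int]_(m, n))); apply/asboolP; exists 0 => //.
by split=> i j; rewrite ?mxE // big1 // => k _; rewrite mxE.
Qed.

Lemma srm_nonzero_count_le (m n k : nat) :
  srm_nonzero_count m n k -> (k <= m * n)%N.
Proof.
move=> /asboolP[A _ <-]; apply: leq_trans (max_card _) _.
by rewrite card_prod !card_ord.
Qed.

(* zeta 1 n = n, and zeta m n = n ^ 2 as soon as m >= 2n - 1 (column j has at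
   most 2j - 1 nonzero entries).  The closed formula for zeta m n agrees with
   this only when m <= 2n + 2 and, if m = 1, n = 1; hence the range imposed on
   (m, n) in the theorem. *)
Definition zeta (m n : nat) : nat :=
  ex_maxn (@srm_nonzero_count_ex m n) (@srm_nonzero_count_le m n).

(* Main.v *)
(* Write c = m/2 (rounded down), h = n - c, and let z be the number of zero
   entries in the last h columns.  Column j (from 0) has at most 2j + 1 nonzero
   entries: each -1 in it must be paid for by the first j columns, whose total
   sum is at most j.  For the last h columns, look at the even-numbered rows
   (odd i, counting from 0): a column without zeros alternates 1, -1, 1, ...,
   hence sums to -c over these c rows, and any other column sums to at most c.
   The first c columns contribute at most c to these rows, whose total is
   nonnegative, so 2 z >= h - 1.  Thus zeta m n <= c^2 + m h - h/2, and a
   diamond-shaped block followed by alternating columns attains the bound. *)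
Require Import Defs.
From mathcomp Require Import all_boot all_order all_algebra.
From mathcomp Require Import boolp zify ring lra.
Set Implicit Arguments.
Unset Strict Implicit.
Unset Printing Implicit Defensive.
Import Order.TTheory GRing.Theory Num.Theory.
Local Open Scope ring_scope.

(** * Partial sums of rows and columns *)

Lemma sum_ltnS (V : zmodType) (n : nat) (F : 'I_n -> V) (i : 'I_n) :
  \sum_(k < n | (k < i.+1)%N) F k = \sum_(k < n | (k < i)%N) F k + F i.
Proof.
rewrite (bigD1 i) //= addrC; congr (_ + _); apply: eq_bigl => k.
by rewrite ltnS [in RHS]ltn_neqAle andbC.
Qed.

Lemma srm_entry (m n : nat) (A : 'M[int]_(m, n)) (i : 'I_m) (j : 'I_n) :
  is_srm A -> [\/ A i j = 0, A i j = 1 | A i j = -1].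
Proof.
by case=> /(_ i j) + _ _; rewrite !inE => /or3P[] /eqP;
  [constructor 1 | constructor 2 | constructor 3].
Qed.

Lemma row_prefix_ge0 (m n k : nat) (A : 'M[int]_(m, n)) (i : 'I_m) :
  is_srm A -> 0 <= \sum_(l < n | (l < k)%N) A i l.
Proof. by case=> _ _ rowA; case: k => [|k]; [rewrite big_pred0 | apply: rowA]. Qed.

Lemma col_prefix_bounds (m n k : nat) (A : 'M[int]_(m, n)) (j : 'I_n) :
  is_srm A -> 0 <= \sum_(i < m | (i < k)%N) A i j <= 1.
Proof.
case=> _ colA _; case: k => [|k]; first by rewrite big_pred0.
by have := colA k j; rewrite !inE => /orP[] /eqP /= ->.
Qed.

Lemma col_sum_bounds (m n : nat) (A : 'M[int]_(m, n)) (j : 'I_n) :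
  is_srm A -> 0 <= \sum_i A i j <= 1.
Proof.
move=> srmA; have := col_prefix_bounds m j srmA.
by under eq_bigl do rewrite ltn_ord.
Qed.

(** A nonzero entry changes the partial column sum, which can only be 0 or 1; so the sum of the
    first [k] entries is forced to be the parity of [k]. *)
Lemma full_col_alternates (m n : nat) (A : 'M[int]_(m, n)) (j : 'I_n) :
  is_srm A -> (forall i, A i j != 0) -> forall i, A i j = (-1) ^+ odd i.
Proof.
move=> srmA nzA.
have pre k : (k <= m)%N -> \sum_(i < m | (i < k)%N) A i j = (odd k)%:Z.
  elim: k => [|k IHk] le_km; first by rewrite big_pred0.
  have := col_prefix_bounds k.+1 j srmA.
  have := sum_ltnS (A^~ j) (Ordinal le_km) => /= ->.
  rewrite IHk ?(ltnW le_km) //.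
  by have := nzA (Ordinal le_km);
    case: (srm_entry (Ordinal le_km) j srmA) => ->; case: (odd k).
move=> i; have := sum_ltnS (A^~ j) i => /=.
by rewrite !pre ?(ltnW (ltn_ord i)) //=; case: (odd i) => /=; lia.
Qed.

Lemma card_ord_lt (n k : nat) : (k <= n)%N -> #|[pred i : 'I_n | (i < k)%N]| = k.
Proof.
move=> le_kn; rewrite -sum1_card.
rewrite -[RHS]card_ord -sum1_card.
by rewrite (big_ord_widen n (fun=> 1%N) le_kn).
Qed.

(** * Upper bound on the number of nonzero entries *)

Definition col_nonzero (m n : nat) (A : 'M[int]_(m, n)) (j : 'I_n) : nat :=
  (\sum_(i < m) (A i j != 0))%N.

Lemma num_nonzeroE (m n : nat) (A : 'M[int]_(m, n)) :
  num_nonzero A = (\sum_(j < n) col_nonzero A j)%N.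
Proof.
rewrite /num_nonzero -sum1_card /col_nonzero exchange_big pair_big /=.
rewrite big_mkcond /=; apply: eq_bigr => -[i j] _; rewrite inE /=.
by case: (_ != _).
Qed.

Lemma col_nonzero_le_rows (m n : nat) (A : 'M[int]_(m, n)) (j : 'I_n) :
  (col_nonzero A j <= m)%N.
Proof.
rewrite -[leqRHS]card_ord -sum1_card.
by apply: leq_sum => i _; case: (_ != _).
Qed.

Lemma col_nonzero_le (m n : nat) (A : 'M[int]_(m, n)) (j : 'I_n) :
  is_srm A -> (col_nonzero A j <= j.*2.+1)%N.
Proof.
move=> srmA; pose P i := \sum_(l < n | (l < j)%N) A i l.
(* As A i j + P i >= 0 and P i >= 0, we have |A i j| <= A i j + 2 P i. *)
suff : (col_nonzero A j)%:Z <= \sum_i (A i j + 2 * P i).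
  (* Column [j] sums to at most 1, and the [j] columns before it to at most [j] in all. *)
  rewrite big_split -mulr_sumr /= /P exchange_big /=.
  have /andP[_] := col_sum_bounds j srmA.
  have : \sum_(l < n | (l < j)%N) \sum_i A i l <= \sum_(l < n | (l < j)%N) 1.
    by apply: ler_sum => l _; have /andP[] := col_sum_bounds l srmA.
  rewrite sumr_const card_ord_lt ?(ltnW (ltn_ord j)) // natz.
  set S := \sum_(l < n | (l < j)%N) _; set T := \sum_i _.
  by move: S T => S T; lia.
rewrite /col_nonzero -natz natr_sum; apply: ler_sum => i _.
have := row_prefix_ge0 j i srmA.
have := row_prefix_ge0 j.+1 i srmA.
rewrite sum_ltnS -/(P i).
by case: (srm_entry i j srmA) => ->; rewrite ?eqxx /=; lia.
Qed.

Lemma card_odd_ord (m : nat) : (\sum_(i < m) odd i)%N = m./2.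
Proof. by elim: m => [|m IHm]; rewrite ?big_ord0 // big_ord_recr /= IHm; lia. Qed.

Definition odd_row_sum (m n : nat) (A : 'M[int]_(m, n)) (j : 'I_n) : int :=
  \sum_(i < m | odd i) A i j.

(** The bound is linear in the number z of zeros of the column, so that it can be summed over
    columns. It is attained at z = 0, where the signs alternate, and is at least the trivial bound
    [m./2] once z is positive. *)
Lemma odd_row_sum_le (m n : nat) (A : 'M[int]_(m, n)) (j : 'I_n) :
  is_srm A ->
  odd_row_sum A j <= (m./2)%:Z * (2 * (m%:Z - (col_nonzero A j)%:Z) - 1).
Proof.
move=> srmA; rewrite /odd_row_sum.
have le_cm := col_nonzero_le_rows A j.
have [/forallP nzA|/forallPn[i0]] := boolP [forall i, A i j != 0].
  have -> : col_nonzero A j = m.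
    rewrite /col_nonzero (eq_bigr (fun=> 1%N)) ?sum1_card ?card_ord // => i _.
    by rewrite nzA.
  rewrite (eq_bigr (fun i : 'I_m => - (odd i)%:Z)); last first.
    by move=> i odd_i; rewrite (full_col_alternates srmA nzA) odd_i.
  rewrite sumrN -card_odd_ord big_mkcond -natz natr_sum /=.
  rewrite [\sum_(i < m) (if _ then _ else _)]
    (eq_bigr (fun i : 'I_m => (odd i)%:R)).
    by rewrite subrr mulr0 sub0r mulrN1.
  by move=> i _; case: (odd i).
rewrite negbK => /eqP A0.
have lt_cm : (col_nonzero A j < m)%N.
  rewrite /col_nonzero (bigD1 i0) //= A0 eqxx add0n.
  rewrite -[ltnRHS]card_ord -sum1_card [ltnRHS](bigD1 i0) //= add1n ltnS.
  by apply: leq_sum => i _; case: (_ != _).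
apply: (@le_trans _ _ (m./2)%:Z); last nia.
rewrite -card_odd_ord -natz natr_sum big_mkcond /=; apply: ler_sum => i _.
by case: odd => //; case: (srm_entry i j srmA) => ->.
Qed.

Lemma sum_odd (c : nat) : (\sum_(j < c) j.*2.+1 = c ^ 2)%N.
Proof. by elim: c => [|c IHc]; rewrite ?big_ord0 // big_ord_recr /= IHc; nia. Qed.

(** In the first alternative of the condition, the inequality for the odd-indexed rows carries a
    factor [c] that can be cancelled; in the second, [h./2 = 0] and counting all the entries of the
    last columns is enough. *)
Lemma num_nonzero_le (m c h : nat) (A : 'M[int]_(m, c + h)) :
  is_srm A -> ((0 < c) && (m./2 == c) || (h <= 1))%N ->
  (num_nonzero A + h./2 <= c ^ 2 + m * h)%N.
Proof.
move=> srmA cond; rewrite num_nonzeroE big_split_ord /=.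
have le_left : (\sum_(j < c) col_nonzero A (lshift h j) <= c ^ 2)%N.
  by rewrite -sum_odd; apply: leq_sum => j _; apply: col_nonzero_le.
set R := (\sum_(j < h) _)%N.
suff le_right : (R + h./2 <= m * h)%N by rewrite -addnA leq_add.
case/orP: cond => [/andP[c_gt0 /eqP def_c]|h_le1]; last first.
  suff : (R <= m * h)%N by lia.
  rewrite mulnC -[in leqRHS](card_ord h) -sum_nat_const; apply: leq_sum => j _.
  exact: col_nonzero_le_rows.
have ge0 : 0 <= \sum_(i < m | odd i) \sum_(j < c + h) A i j.
  apply: sumr_ge0 => i _; have := row_prefix_ge0 (c + h) i srmA.
  by under eq_bigl do rewrite ltn_ord.
(* Each row has a nonnegative sum over the first [c] columns, so adding the other rows only
   increases the total, and each column sums to at most 1. *)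
have le_c : \sum_(i < m | odd i) \sum_(j < c) A i (lshift h j) <= c%:Z.
  apply: (@le_trans _ _ (\sum_(i < m) \sum_(j < c) A i (lshift h j))).
    rewrite big_mkcond /=; apply: ler_sum => i _; case: odd => //.
    have := row_prefix_ge0 c i srmA.
    rewrite big_split_ord /= [X in _ + X]big_pred0 ?addr0; last by move=> j; lia.
    by under eq_bigl do rewrite ltn_ord.
  rewrite exchange_big /= -[c in leRHS]card_ord -sum1_card -natz natr_sum.
  by apply: ler_sum => j _; have /andP[] := col_sum_bounds (lshift h j) srmA.
(* The last [h] columns have [m * h - R] zeros in all. *)
have : \sum_(i < m | odd i) \sum_(j < h) A i (rshift c j)
    <= c%:Z * (2 * (m%:Z * h%:Z - R%:Z) - h%:Z).
  rewrite exchange_big /=.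
  have -> : c%:Z * (2 * (m%:Z * h%:Z - R%:Z) - h%:Z)
    = \sum_(j < h) c%:Z * (2 * (m%:Z - (col_nonzero A (rshift c j))%:Z) - 1).
    rewrite -mulr_sumr sumrB -mulr_sumr sumrB !sumr_const !card_ord.
    have -> : R%:Z = \sum_(j < h) (col_nonzero A (rshift c j))%:Z.
      by rewrite -natz natr_sum; apply: eq_bigr => j _; rewrite natz.
    by rewrite -(mulr_natr m%:Z h) !natz; ring.
  by apply: ler_sum => j _; have := odd_row_sum_le (rshift c j) srmA; rewrite def_c.
move: ge0; under eq_bigr do rewrite big_split_ord /=.
rewrite big_split /= => ge0 le_odd_right.
(* After cancelling [c], twice the number of zeros is at least [h - 1]; integrality turns this into
   [h./2] zeros. *)
have : 0 <= c%:Z * (2 * (m%:Z * h%:Z - R%:Z) - h%:Z + 1).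
  rewrite mulrDr mulr1 addrC; apply: le_trans ge0 _; exact: lerD.
by rewrite pmulr_rge0 ?ltz_nat //; move: (R) => r; lia.
Qed.

Lemma zeta_eq (m n k : nat) :
  (forall A : 'M[int]_(m, n), is_srm A -> (num_nonzero A <= k)%N) ->
  (exists2 A : 'M[int]_(m, n), is_srm A & num_nonzero A = k) -> zeta m n = k.
Proof.
move=> ub [A srmA nzA]; rewrite /zeta; case: ex_maxnP => l /asboolP[B srmB <-] max_l.
by apply/eqP; rewrite eqn_leq ub //=; apply: max_l; apply/asboolP; exists A.
Qed.

(** * The extremal matrix *)

(* diamond_state c i j is the sum of the first i entries of column j of the
   extremal matrix, and diamond_row c i j the sum of the first j entries of its
   row i, when i > 0. *)
Definition diamond_state (c i j : nat) : bool :=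
  [&& (0 < i)%N, (c < i + j)%N & (c + j + 1 < i)%N || odd (i + c + j)].

Definition diamond_row (c i j : nat) : bool :=
  [&& (c < i + j)%N, (i < c + j)%N & odd (i + c + j)].

Definition diamond (m n c : nat) : 'M[int]_(m, n) :=
  \matrix_(i, j) ((diamond_state c i.+1 j)%:Z - (diamond_state c i j)%:Z).

(** Entries are defined as differences down a column; reading them as differences along a row makes
    row sums telescope too. Row 0 is left out: it has 0 where the alternation would put -1. *)
Lemma diamond_rowE (c i j : nat) : (0 < i)%N -> (j < c)%N || (i <= c.*2)%N ->
  (diamond_state c i.+1 j)%:Z - (diamond_state c i j)%:Z =
  (diamond_row c i j.+1)%:Z - (diamond_row c i j)%:Z.
Proof. by rewrite /diamond_state /diamond_row; lia. Qed.

Lemma telescope_sum_ord (V : zmodType) (n i : nat) (f : nat -> V) (u : 'I_n -> V) :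
  (forall k : 'I_n, u k = f k.+1 - f k) ->
  \sum_(k < n | (k <= i)%N) u k = f (minn n i.+1) - f 0%N.
Proof.
move=> def_u; under eq_bigr do rewrite def_u.
elim: n {u def_u} => [|n IHn]; first by rewrite big_ord0 min0n subrr.
rewrite big_mkcond big_ord_recr -big_mkcond /= IHn; case: leqP => [le_ni|lt_in].
  by rewrite (minn_idPl _) ?(minn_idPl _) // ?leqW // addrC addrA subrK.
by rewrite (minn_idPr _) ?(minn_idPr _) ?addr0 // ltnW.
Qed.

Lemma diamond_srm (m n c : nat) :
  (m <= c.*2.+1)%N || (n <= c)%N -> is_srm (diamond m n c).
Proof.
move=> cond; split=> i j.
- by rewrite mxE; case: diamond_state; case: diamond_state.
- rewrite (@telescope_sum_ord _ _ _ (fun k => (diamond_state c k j)%:Z)) ?subr0.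
    by case: diamond_state.
  by move=> k; rewrite mxE.
have [i0|i_gt0] := posnP i.
  (* Row 0 has no negative entry, since every column state starts at 0. *)
  by apply: sumr_ge0 => l _; rewrite mxE i0 subr0.
rewrite (@telescope_sum_ord _ _ _ (fun l => (diamond_row c i l)%:Z)).
  have -> : diamond_row c i 0 = false by rewrite /diamond_row; lia.
  by rewrite subr0.
move=> l; rewrite mxE diamond_rowE //.
by have := ltn_ord l; have := ltn_ord i; lia.
Qed.

(** The support is the cone |i - c| <= j, less the top entries of columns c + 1, c + 3, and so
    on. *)
Lemma diamond_entry_neq0 (m n c : nat) (i : 'I_m) (j : 'I_n) :
  (m <= c.*2.+1)%N || (n <= c)%N ->
  (diamond m n c i j != 0) =
  [&& (c <= i + j)%N, (i <= c + j)%N & (0 < i)%N || ~~ odd (c + j)].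
Proof.
move=> cond; rewrite mxE /diamond_state.
by have := ltn_ord j; have := ltn_ord i; lia.
Qed.

Lemma sum_ord_interval (m a b : nat) :
  (b <= m)%N -> (\sum_(i < m) ((a <= i) && (i < b)) = b - a)%N.
Proof.
move=> /minn_idPl {2}<-.
elim: m => [|m IHm]; first by rewrite big_ord0 minn0.
rewrite big_ord_recr /= IHm; lia.
Qed.

Lemma num_nonzero_diamond (m c h : nat) : (0 < m)%N -> (c.*2 <= m)%N ->
  (m <= c.*2.+1)%N || (h == 0)%N ->
  (num_nonzero (diamond m (c + h) c) + h./2 = c ^ 2 + m * h)%N.
Proof.
move=> m_gt0 le_cm cond.
have cond' : (m <= c.*2.+1)%N || (c + h <= c)%N by lia.
rewrite num_nonzeroE big_split_ord /= -addnA -sum_odd; congr (_ + _)%N.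
  apply: eq_bigr => j _; have lt_jc := ltn_ord j.
  rewrite /col_nonzero.
  under eq_bigr => i _ do rewrite diamond_entry_neq0 //.
  rewrite (eq_bigr (fun i : 'I_m => (c - j <= i) && (i < c + j.+1) : nat)%N).
    by rewrite sum_ord_interval; lia.
  by move=> i _ /=; lia.
(* Column [c + k] lacks its top entry exactly when [k] is odd, so [h./2] is spread out as the number
   of odd [k < h]. *)
rewrite -card_odd_ord -big_split /= mulnC -[in RHS](card_ord h) -sum_nat_const.
apply: eq_bigr => k _; have lt_kh := ltn_ord k.
rewrite /col_nonzero.
under eq_bigr => i _ do rewrite diamond_entry_neq0 //.
rewrite (eq_bigr (fun i : 'I_m => (odd k <= i) && (i < m) : nat)%N).
  by rewrite sum_ord_interval //; lia.
by move=> i _ /=; have := ltn_ord i; lia.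
Qed.

(** * The closed formulas *)

Lemma zeta_formula (m c h : nat) : (0 < m)%N -> (c.*2 <= m)%N ->
  (m <= c.*2.+1)%N || (h == 0)%N -> (0 < c)%N || (h <= 1)%N ->
  (zeta m (c + h) + h./2 = c ^ 2 + m * h)%N.
Proof.
move=> m_gt0 le_cm cond1 cond2; have count := num_nonzero_diamond m_gt0 le_cm cond1.
rewrite -count; congr (_ + _)%N; apply: zeta_eq.
  move=> A srmA; rewrite -(leq_add2r h./2) count; apply: num_nonzero_le srmA _.
  by lia.
by exists (diamond m (c + h) c) => //; apply: diamond_srm; lia.
Qed.

Lemma zeta_rat (m c h : nat) : (0 < m)%N -> (c.*2 <= m)%N ->
  (m <= c.*2.+1)%N || (h == 0)%N -> (0 < c)%N || (h <= 1)%N ->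
  (zeta m (c + h))%:R = c%:R ^+ 2 + m%:R * h%:R - h./2%:R :> rat.
Proof.
move=> m_gt0 le_cm cond1 cond2.
by rewrite -natrX -natrM -natrD -zeta_formula // natrD addrK.
Qed.

Unset Implicit Arguments.

Theorem theorem2p3 (m n : nat) (m_gt0 : (0 < m)%N) (n_gt0 : (0 < n)%N) :
  ((m <= 2 * n + 2)%N -> (1 < m)%N \/ n = 1%N ->
    (zeta m n)%:R =
      (if ~~ odd m then
         m%:R * n%:R - m%:R ^+ 2 / 4%:R
           - (Num.ceil (1 / 2%:R * (n%:R - m%:R / 2%:R - 1) : rat))%:~R
       else
         m%:R * n%:R - (m%:R ^+ 2 - 1) / 4%:R
           - (Num.ceil (1 / 2%:R * (n%:R - (m%:R + 1) / 2%:R) : rat))%:~R)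
    :> rat)
  /\
  (m = n ->
    (zeta n n)%:R =
      (if (n == 0 %[mod 4]) || (n == 3 %[mod 4]) then
         (3%:R * n%:R ^+ 2 - n%:R) / 4%:R
       else
         (3%:R * n%:R ^+ 2 - n%:R + 2%:R) / 4%:R)
    :> rat).
Proof.
(* With [h = n - m./2], the argument of the ceiling is (h - 1)/2 for both parities of [m]. *)
have ceil_half h : Num.ceil (1 / 2 * (h%:R - 1) : rat) = h./2%:Z.
  apply: ceil_def; rewrite -{2 3}(odd_double_half h) -addnn !natrD.
  by case: (odd h) => /=; rewrite intrB -pmulrn; apply/andP; split; lra.
split=> [m_le m_gt1_or|_].
  set c := m./2; have [le_cn|lt_nc] := leqP c n.
    rewrite -(subnKC le_cn); set h := (n - c)%N.
    rewrite zeta_rat; [|lia..].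
    have -> : m%:R = (odd m)%:R + c%:R + c%:R :> rat.
      by rewrite -addrA -!natrD addnn odd_double_half.
    by case: (odd m) => /=;
      (rewrite (_ : 1 / 2 * _ = 1 / 2 * (h%:R - 1)); last by rewrite natrD; field);
      rewrite ceil_half -pmulrn natrD; field.
  (* Only m = 2n + 2 is left. Taking [c = n] and no further columns gives n^2, and the ceiling in
     the formula is that of -1. *)
  have -> : m = (n.+1).*2 by lia.
  rewrite odd_double /= -[X in zeta _ X]addn0 zeta_rat; [|lia..].
  have -> : (n.+1).*2%:R = 2 * n%:R + 2 :> rat.
    by rewrite -mul2n natrM -addn1 natrD; ring.
  rewrite (_ : 1 / 2 * _ = (-1)%:~R); last by field.
  by rewrite intrKceil /=; field.
set c := n./2; set h := (n - c)%N.
have nE : n = (c + h)%N by lia.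
rewrite [X in zeta _ X]nE zeta_rat; [|lia..].
(* [h] is n/2 rounded up, so its parity depends only on n modulo 4. *)
have -> : (n == 0 %[mod 4]) || (n == 3 %[mod 4]) = ~~ odd h by lia.
have nR : n%:R = (odd n)%:R + c%:R + c%:R :> rat.
  by rewrite -addrA -!natrD addnn odd_double_half.
have hR : h%:R = (odd h)%:R + h./2%:R + h./2%:R :> rat.
  by rewrite -addrA -!natrD addnn odd_double_half.
have nR' : n%:R = c%:R + h%:R :> rat by rewrite nE natrD.
have cR : c%:R = h%:R - (odd n)%:R :> rat by lra.
rewrite nR cR hR.
by case: (odd h); case: (odd n) => /=; field.
Qed.
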